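(* Let $P\subset\mathbb R^d$ be a rational $d$-polytope with $P=-P$. The following are equivalent: (1) $\mathrm{ehr}_{P+\bm v}$ is symmetric for every $\bm v\in\mathbb Q^d$; (2) $2P$ is an integral polytope (all vertices of $2P$ lie in $\mathbb Z^d$).
   Context: A quasi-polynomial is symmetric if its $k$th constituent equals its $(-k)$th constituent for all $k\in\mathbb Z$ (constituents indexed by residues modulo a period). $\mathrm{ehr}_X(t)=\#(tX\cap\mathbb Z^d)$ for $t\in\mathbb Z_{\ge0}$, extended to $\mathbb Z$ as a quasi-polynomial; $P+\bm v=\{\bm x+\bm v:\bm x\in P\}$. *)

(* Defs.v *)
From HB Require Import structures.
From mathcomp Require Import all_boot all_order all_algebra.
From mathcomp Require Import boolp classical_sets reals.
Set Implicit Arguments. Unset Strict Implicit. Unset Printing Implicit Defensive.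
Import Order.TTheory GRing.Theory Num.Theory.
Local Open Scope ring_scope.
Local Open Scope classical_set_scope.

Section Defs.
Variables (R : realType) (d : nat).
Notation vec := 'rV[R]_d.

Definition conv (V : seq vec) : set vec :=
  [set x | exists l : 'I_(size V) -> R,
     (forall i, 0 <= l i) /\ \sum_i l i = 1 /\ x = \sum_i l i *: V`_i].

Definition is_polytope (P : set vec) : Prop := exists V : seq vec, P = conv V.

Definition full_dim (P : set vec) : Prop :=
  exists x : vec, exists2 e : R, 0 < e &
    forall y : vec, (forall i, `|y 0 i - x 0 i| < e) -> P y.

Definition is_vertex (P : set vec) (x : vec) : Prop :=
  P x /\ forall y z : vec, P y -> P z -> forall l : R, 0 < l < 1 ->
    x = l *: y + (1 - l) *: z -> y = z.

Definition rational_pt (x : vec) : Prop :=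
  exists q : 'rV[rat]_d, x = map_mx (fun r => ratr r) q.
Definition integral_pt (x : vec) : Prop :=
  exists z : 'rV[int]_d, x = map_mx (fun n : int => n%:~R) z.

Definition rational_polytope (P : set vec) : Prop :=
  is_polytope P /\ forall x, is_vertex P x -> rational_pt x.
Definition integral_polytope (P : set vec) : Prop :=
  is_polytope P /\ forall x, is_vertex P x -> integral_pt x.

Definition dilate (t : R) (X : set vec) : set vec :=
  [set y | exists2 x, X x & y = t *: x].
Definition translate (X : set vec) (v : vec) : set vec :=
  [set y | exists2 x, X x & y = x + v].

Definition lattice_pts (X : set vec) (t : nat) : set 'rV[int]_d :=
  [set z | dilate t%:R X (map_mx (fun n : int => n%:~R) z)].

Definition has_card (T : eqType) (A : set T) (n : nat) : Prop :=
  exists s : seq T, [/\ uniq s, size s = n & forall x, x \in s <-> A x].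

Definition ehr (X : set vec) (t : nat) : nat :=
  xget 0%N [set n | has_card (lattice_pts X t) n].

Definition quasi_poly_rep (f : nat -> nat) (N : nat) (p : nat -> {poly R}) : Prop :=
  (0 < N)%N /\ forall t : nat, (f t)%:R = (p (t %% N)%N).[t%:R].

(* the quasi-polynomial (extension of) f is symmetric: its k-th constituent
   equals its (-k)-th constituent, residues taken modulo the period *)
Definition symmetric_qp (f : nat -> nat) : Prop :=
  exists N p, quasi_poly_rep f N p /\
    forall k : nat, (k < N)%N -> p k = p ((N - k) %% N)%N.

Definition neg_sym (P : set vec) : Prop := forall x, P x <-> P (- x).

End Defs.

(* Main.v *)
Require Import Defs.
From HB Require Import structures.
From mathcomp Require Import all_boot all_order all_algebra.
From mathcomp Require Import boolp classical_sets reals.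
From mathcomp Require Import ring lra zify.
Import Order.TTheory GRing.Theory Num.Theory.
Local Open Scope ring_scope.
Set Implicit Arguments. Unset Strict Implicit. Unset Printing Implicit Defensive.

(** Both implications rest on one tool: on a given finite family of rational
    polyhedra, the Euler characteristic (1 on nonempty sets, 0 on the empty one)
    is a fixed finite integer combination of evaluations at rational points.

    If 2P is integral with vertices 2 w_i (1 <= i <= m), the polyhedra
    {l >= 0 : sum l_i w_i = x, sum l_i = t, l_i >= 2 for i in I} satisfy a
    pointwise inclusion-exclusion identity when t >= 2m; applying the Euler
    functional and counting lattice points shows that the m-th difference of
    t |-> #((tP + u) /\ Z^d), taken with step 2, vanishes.  So this count is a
    polynomial on each parity class, and it is even in u because P = -P.

    Conversely let v be a vertex.  Applied to the tangent cones of P, the Euler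
    functional yields finitely many small shifts e and weights c such that
    sum c [x + e in tP] = [x = tv] for all x in Z^d + v and all t >= 1.  Counting
    over x, a weighted sum of Ehrhart functions of translates of P is 1 for
    t = 1 modulo M, and for t = -1 modulo M it is 1 or 0 according to whether 2v
    is a lattice point.  By symmetry both classes share one polynomial. *)

(** * Dilates of a convex hull *)

Section ConicCombinations.
Variables (F : realFieldType) (d : nat).
Implicit Types (V W : seq 'rV[F]_d) (x y v : 'rV[F]_d) (h a : F).

(* The h-th dilate of conv V; [conv V] is convertible to [conv_at V 1]. *)
Definition conv_at V h x : Prop := exists l : 'I_(size V) -> F,
  (forall i, 0 <= l i) /\ \sum_i l i = h /\ x = \sum_i l i *: V`_i.

Lemma conv_at_nil h x : conv_at [::] h x <-> h = 0 /\ x = 0.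
Proof.
split=> [[l [_ [<- ->]]]|[-> ->]]; first by rewrite !big_ord0.
by exists (fun=> 0); rewrite !big_ord0.
Qed.

(** Splitting off the coefficient [a] of the first point permits induction on the list and exhibits
    the dilate as a projection along one variable. *)
Lemma conv_at_cons v V h x :
  conv_at (v :: V) h x <-> exists2 a, 0 <= a & conv_at V (h - a) (x - a *: v).
Proof.
split=> [[l [l0 [<- ->]]]|[a a0 [l [l0 [lh lx]]]]].
  exists (l ord0); first exact: l0.
  exists (fun i => l (lift ord0 i)); split=> [i|]; first exact: l0.
  by rewrite !big_ord_recl /= ![_ + _ - _]addrAC !subrr !add0r.
exists (fun i => oapp l a (unlift ord0 i)); split=> [i|].
  by case: (unlift ord0 i) => [j|] //=; apply: l0.
rewrite !big_ord_recl /= unlift_none /=; under eq_bigr do rewrite liftK /=.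
rewrite lh; under [in X in _ /\ X]eq_bigr do rewrite liftK /=.
by rewrite -lx; split; rewrite addrC subrK.
Qed.

Lemma conv_at_ge0 V h x : conv_at V h x -> 0 <= h.
Proof. by case=> l [l0 [<- _]]; apply: sumr_ge0. Qed.

Lemma conv_at0 V x : conv_at V 0 x <-> x = 0.
Proof.
split=> [[l [l0 [lh ->]]]|->]; last first.
  by exists (fun=> 0); split=> //; split; rewrite big1 // => i _; rewrite scale0r.
apply: big1 => i _.
have /psumr_eq0P/(_ lh) -> // : forall i, true -> 0 <= l i by [].
by rewrite scale0r.
Qed.

Lemma conv_at_add V h1 h2 x1 x2 :
  conv_at V h1 x1 -> conv_at V h2 x2 -> conv_at V (h1 + h2) (x1 + x2).
Proof.
case=> l [l0 [<- ->]] [k [k0 [<- ->]]]; exists (fun i => l i + k i).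
split=> [i|]; first by rewrite addr_ge0.
by rewrite -!big_split; split=> //; apply: eq_bigr => i _; rewrite scalerDl.
Qed.

Lemma conv_at_scale V a h x : 0 <= a -> conv_at V h x -> conv_at V (a * h) (a *: x).
Proof.
move=> a0 [l [l0 [<- ->]]]; exists (fun i => a * l i).
split=> [i|]; first by rewrite mulr_ge0.
rewrite mulr_sumr scaler_sumr; split=> //.
by apply: eq_bigr => i _; rewrite scalerA.
Qed.

Lemma conv_at_mem V v : v \in V -> conv_at V 1 v.
Proof.
elim: V => // w V IH; rewrite inE => /orP[/eqP->|/IH vV]; apply/conv_at_cons.
  by exists 1 => //; rewrite scale1r !subrr; apply/conv_at0.
by exists 0 => //; rewrite scale0r !subr0.
Qed.

Lemma conv_at_sub V W h x :
  (forall v, v \in V -> conv_at W 1 v) -> conv_at V h x -> conv_at W h x.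
Proof.
elim: V h x => [|v V IH] h x VW; first by case/conv_at_nil=> -> ->; apply/conv_at0.
case/conv_at_cons=> a a0 /IH kx.
rewrite -[h](subrK a) -[x](subrK (a *: v)); apply: conv_at_add.
  by apply: kx => w wV; apply: VW; rewrite inE wV orbT.
by rewrite -[X in conv_at _ X _]mulr1; apply: conv_at_scale => //; apply: VW; rewrite inE eqxx.
Qed.

End ConicCombinations.

(** Let [v = l y + (1 - l) z], where [v] has weight [a] in [y] and [b] in [z], and put
    [c = l a + (1 - l) b]. If [c < 1], cancelling the share [c] of [v] expresses it through [V];
    otherwise [a = b = 1] and [y = z = v]. *)
Lemma conv_at_nonvertex (R : realType) d (V : seq 'rV[R]_d) v :
  ~ is_vertex (conv (v :: V)) v -> conv_at V 1 v.
Proof.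
apply: contra_notP => nv; split; first by apply: (@conv_at_mem _ _ (v :: V)); rewrite inE eqxx.
move=> y z /conv_at_cons[a a0 ky] /conv_at_cons[b b0 kz] l /andP[l0 l1] vE.
have a1 : a <= 1 by move/conv_at_ge0: (ky); rewrite subr_ge0.
have b1 : b <= 1 by move/conv_at_ge0: (kz); rewrite subr_ge0.
pose c := l * a + (1 - l) * b.
have kv : conv_at V (1 - c) ((1 - c) *: v).
  have := conv_at_add (conv_at_scale (ltW l0) ky) (@conv_at_scale _ _ _ (1 - l) _ _ _ kz).
  rewrite subr_ge0 (ltW l1) => /(_ isT).
  congr conv_at; first by rewrite /c; ring.
  rewrite [RHS]scalerBl scale1r [X in _ = X - _]vE /c !scalerBr !scalerA.
  by rewrite [(_ * a + _) *: v]scalerDl opprD addrACA.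
have [c1|c1] := ltP c 1.
  case: nv; rewrite -[v]scale1r -(@mulVf _ (1 - c)); last by rewrite subr_eq0 gt_eqF.
  by rewrite -scalerA; apply: conv_at_scale => //; rewrite invr_ge0 subr_ge0 ltW.
have a1E : a = 1 by rewrite /c in c1; nra.
have b1E : b = 1 by rewrite /c in c1; nra.
move: ky kz; rewrite a1E b1E subrr scale1r => /conv_at0/eqP + /conv_at0/eqP.
by rewrite !subr_eq0 => /eqP-> /eqP->.
Qed.

Lemma conv_vertices (R : realType) d (V : seq 'rV[R]_d) :
  exists2 W, conv V = conv W & forall w, w \in W -> is_vertex (conv V) w.
Proof.
have [n] := ubnP (size V); elim: n V => // n IH V szV.
have [allV|] := pselect (forall w, w \in V -> is_vertex (conv V) w); first by exists V.
move/existsNP=> [w /not_implyP[wV nw]].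
pose V' := rem w V.
have VE : conv V = conv (w :: V').
  apply/seteqP; split=> x; apply: conv_at_sub => v.
    by rewrite (perm_mem (perm_to_rem wV)) => /conv_at_mem.
  by rewrite -(perm_mem (perm_to_rem wV)) => /conv_at_mem.
have kw : conv_at V' 1 w by apply: conv_at_nonvertex; rewrite -VE.
have V'E : conv V = conv V'.
  rewrite VE; apply/seteqP; split=> x; apply: conv_at_sub => v.
    by rewrite inE => /orP[/eqP->|/conv_at_mem].
  by move=> vV; apply: conv_at_mem; rewrite inE vV orbT.
rewrite V'E; apply: IH; rewrite size_rem //.
by move: szV wV; case: (V) => //= ? ?; rewrite ltnS.
Qed.

(** * Rational polyhedra and the Euler functional *)

(** Coefficients stay rational so that one system can be read in every ordered field. *)
Definition aff n := ({ffun 'I_n -> rat} * rat)%type.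

Definition aval (F : realFieldType) n (c : aff n) (x : 'I_n -> F) : F :=
  \sum_i ratr (c.1 i) * x i + ratr c.2.

Definition sat (F : realFieldType) n (S : seq (aff n)) (x : 'I_n -> F) : bool :=
  all (fun c => 0 <= aval c x) S.

Definition fcons (T : Type) n (y : T) (x : 'I_n -> T) : 'I_n.+1 -> T :=
  fun i => oapp x y (unlift ord0 i).

Definition aff_tail n (c : aff n.+1) : aff n :=
  ([ffun i => c.1 (lift ord0 i)], c.2).

Lemma fcons0 T n (y : T) (x : 'I_n -> T) : fcons y x ord0 = y.
Proof. by rewrite /fcons unlift_none. Qed.

Lemma fconsS T n (y : T) (x : 'I_n -> T) i : fcons y x (lift ord0 i) = x i.
Proof. by rewrite /fcons liftK. Qed.

Lemma fcons_eta T n (x : 'I_n.+1 -> T) : x = fcons (x ord0) (fun i => x (lift ord0 i)).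
Proof.
by apply/funext => i; case: (unliftP ord0 i) => [j|] ->; rewrite ?fcons0 ?fconsS.
Qed.

Lemma aval_fcons (F : realFieldType) n (c : aff n.+1) y (x : 'I_n -> F) :
  aval c (fcons y x) = ratr (c.1 ord0) * y + aval (aff_tail c) x.
Proof.
rewrite /aval big_ord_recl fcons0 -addrA; congr (_ + (_ + _)).
by apply: eq_bigr => i _; rewrite fconsS ffunE.
Qed.

Definition aff_comb n (a b : rat) (c e : aff n) : aff n :=
  ([ffun i => a * c.1 i + b * e.1 i], a * c.2 + b * e.2).

Lemma aval_comb (F : realFieldType) n a b (c e : aff n) (x : 'I_n -> F) :
  aval (aff_comb a b c e) x = ratr a * aval c x + ratr b * aval e x.
Proof.
rewrite /aval /= rmorphD !rmorphM !mulrDr addrACA; congr (_ + _).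
rewrite !mulr_sumr -big_split; apply: eq_bigr => i _ /=.
by rewrite ffunE rmorphD !rmorphM mulrDl !mulrA.
Qed.

Lemma exists_maximum (F : realFieldType) (s : seq F) x :
  x \in s -> exists2 m, m \in s & forall y, y \in s -> y <= m.
Proof.
elim: s x => // z [|w s] IH x _.
  by exists z => [|y]; rewrite inE // => /eqP->.
have [m ms mP] := IH w (mem_head _ _).
have [zm|mz] := leP z m; [exists m|exists z]; rewrite ?mem_head //.
- by rewrite inE ms orbT.
- by move=> y; rewrite inE => /orP[/eqP->|/mP].
- by move=> y; rewrite inE => /orP[/eqP->//|/mP/le_trans->//]; apply: ltW.
Qed.

Lemma separating_point (F : realFieldType) (L U : seq F) :
  {in L & U, forall l u, l <= u} ->
  exists y, {in L, forall l, l <= y} /\ {in U, forall u, y <= u}.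
Proof.
move=> LU; case: L LU => [|l0 L] LU.
  case: U LU => [|u0 U] _; first by exists 0.
  have [m _ mP] := @exists_maximum F [seq - u | u <- u0 :: U] (- u0) (mem_head _ _).
  exists (- m); split=> // u uU; rewrite lerNl; apply: mP.
  exact: (map_f (fun u => - u)).
have [m mL mP] := @exists_maximum F (l0 :: L) l0 (mem_head _ _).
by exists m; split=> // u uU; apply: LU.
Qed.

(* Fourier-Motzkin elimination; the eliminated system does not depend on the
   ordered field, which is what lets real solutions descend to rational ones. *)
Lemma fourier_motzkin n (S : seq (aff n.+1)) :
  exists S' : seq (aff n), forall (F : realFieldType) (x : 'I_n -> F),
    sat S' x <-> exists y, sat S (fcons y x).
Proof.
pose lead (c : aff n.+1) := c.1 ord0.
pose Z := [seq c <- S | lead c == 0].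
pose P := [seq c <- S | 0 < lead c].
pose N := [seq c <- S | lead c < 0].
(* Forms free of the eliminated variable are kept; each pair with leading coefficients of opposite
   sign contributes the positive combination that cancels it. *)
exists (map (@aff_tail n) Z ++
  [seq aff_comb (lead c) (- lead e) (aff_tail e) (aff_tail c) | c <- P, e <- N]).
move=> F x; rewrite /sat all_cat all_map; split; last first.
  case=> y /allP Sy; apply/andP; split.
    apply/allP => c; rewrite mem_filter => /andP[/eqP c0 /Sy].
    by rewrite aval_fcons -/(lead c) c0 rmorph0 mul0r add0r.
  apply/allP => _ /allpairsP[[c e] /= [+ + ->]].
  rewrite !mem_filter => /andP[c0 cS] /andP[e0 eS].
  have {}c0 : 0 < ratr (lead c) :> F by rewrite ltr0q.
  have {}e0 : ratr (lead e) < 0 :> F by rewrite ltrq0.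
  have := mulr_ge0 (ltW c0) (Sy _ eS).
  have := mulr_le0_ge0 (ltW e0) (Sy _ cS).
  rewrite !aval_fcons aval_comb rmorphN -/(lead c) -/(lead e).
  lra.
case/andP=> /allP ZP /allP PN.
(* The bound that [c] puts on [y]: a lower one for [c] in [P], an upper one for [c] in [N]. *)
pose bd (c : aff n.+1) : F := - aval (aff_tail c) x / ratr (lead c).
have [|y [Ly Uy]] := @separating_point F (map bd P) (map bd N).
  move=> _ _ /mapP[c cP ->] /mapP[e eN ->].
  have /PN : aff_comb (lead c) (- lead e) (aff_tail e) (aff_tail c) \in
     [seq aff_comb (lead c) (- lead e) (aff_tail e) (aff_tail c) | c <- P, e <- N].
    by apply/allpairsP; exists (c, e).
  rewrite aval_comb rmorphN /bd.
  have a0 : 0 < ratr (lead c) :> F by move: cP; rewrite mem_filter ltr0q => /andP[].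
  have b0 : ratr (lead e) < 0 :> F by move: eN; rewrite mem_filter ltrq0 => /andP[].
  by move=> H; rewrite ler_pdivrMr // mulrAC ler_ndivlMr //; lra.
exists y; apply/allP => c cS; rewrite aval_fcons -/(lead c).
have [c0|c0|c0] := ltgtP (lead c) 0.
- have : bd c \in map bd N by apply: map_f; rewrite mem_filter c0.
  move/Uy; rewrite /bd.
  have : ratr (lead c) < 0 :> F by rewrite ltrq0.
  move: (ratr _) (aval _ _) => a r a0; rewrite ler_ndivlMr //; lra.
- have : bd c \in map bd P by apply: map_f; rewrite mem_filter c0.
  move/Ly; rewrite /bd.
  have : 0 < ratr (lead c) :> F by rewrite ltr0q.
  move: (ratr _) (aval _ _) => a r a0; rewrite ler_pdivrMr //; lra.
- have /ZP /= : c \in Z by rewrite mem_filter c0 eqxx.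
  by rewrite c0 rmorph0 mul0r add0r.
Qed.

Definition aff1 n (a : rat) (i : 'I_n) (b : rat) : aff n :=
  ([ffun j => a * (j == i)%:R], b).

Lemma aval_aff1 (F : realFieldType) n a (i : 'I_n) b (x : 'I_n -> F) :
  aval (aff1 a i b) x = ratr a * x i + ratr b.
Proof.
rewrite /aval (bigD1 i) //= ffunE eqxx mulr1 big1 ?addr0 // => j /negbTE ji.
by rewrite ffunE ji mulr0 rmorph0 mul0r.
Qed.

(** Systems only contain conditions [0 <= c], so an equation becomes two opposite inequalities. *)
Definition eqns n (cs : seq (aff n)) : seq (aff n) := cs ++ map (fun c => aff_comb (-1) 0 c c) cs.

Lemma sat_eqns (F : realFieldType) n (cs : seq (aff n)) (x : 'I_n -> F) :
  sat (eqns cs) x = all (fun c => aval c x == 0) cs.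
Proof.
rewrite /sat all_cat all_map -all_predI; apply: eq_all => c /=.
by rewrite aval_comb rmorphN rmorph1 rmorph0 mul0r addr0 mulN1r oppr_ge0 andbC -eq_le.
Qed.

(** Weyl's theorem for the cone over the hull, with one system valid in all ordered fields: a new
    generator adds one nonnegative variable, its coefficient, which Fourier-Motzkin elimination
    projects away. *)
Lemma cone_polyhedral d (W : seq 'rV[rat]_d) :
  exists S : seq (aff d.+1), forall (F : realFieldType) (h : F) (x : 'rV[F]_d),
    sat S (fcons h (x 0)) <-> conv_at (map (map_mx ratr) W) h x.
Proof.
elim: W => [|v W [S SP]].
  exists (eqns [seq aff1 1 i 0 | i <- enum 'I_d.+1]) => F h x.
  rewrite conv_at_nil sat_eqns; split=> [/allP H|[-> ->]].
    have {}H i : fcons h (x 0) i = 0.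
      have /eqP := H _ (map_f _ (mem_enum _ i)).
      by rewrite aval_aff1 rmorph1 rmorph0 addr0 mul1r.
    split; first by rewrite -(H ord0) fcons0.
    by apply/rowP => i; rewrite mxE -(H (lift ord0 i)) fconsS.
  apply/allP => _ /mapP[i _ ->]; rewrite aval_aff1 /fcons rmorph0 addr0 mulf_eq0.
  by case: (unlift _ _) => [j|] /=; rewrite ?mxE eqxx orbT.
(* Pullback of [c] along [(y, h, x) -> (h - y, x - y v)]. *)
pose subst (c : aff d.+1) : aff d.+2 :=
  ([ffun i => oapp c.1 (- (c.1 ord0 + \sum_k c.1 (lift ord0 k) * v 0 k)) (unlift ord0 i)], c.2).
have substE (F : realFieldType) c (y h : F) (x : 'rV[F]_d) :
    aval (subst c) (fcons y (fcons h (x 0))) =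
    aval c (fcons (h - y) ((x - y *: map_mx ratr v) 0)).
  rewrite aval_fcons /= ffunE unlift_none /=.
  have -> : aff_tail (subst c) = c.
    by case: (c) => c1 c2; congr pair; apply/ffunP => i; rewrite !ffunE liftK.
  rewrite !aval_fcons mulrBr rmorphN mulNr rmorphD rmorph_sum /aval.
  under [X in _ = _ + (X + _)]eq_bigr do rewrite !mxE mulrBr.
  rewrite big_split /= sumrN mulrDl mulr_suml.
  have -> : \sum_i ratr ((aff_tail c).1 i) * (y * ratr (v 0 i)) =
      \sum_i ratr (c.1 (lift ord0 i) * v 0 i) * y.
    by apply: eq_bigr => i _; rewrite ffunE [ratr (_ * _)]rmorphM mulrCA mulrC.
  ring.
have [S' S'P] := fourier_motzkin (aff1 1 ord0 0 :: map subst S).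
exists S' => F h x; rewrite S'P map_cons conv_at_cons.
have E y : sat (aff1 1 ord0 0 :: map subst S) (fcons y (fcons h (x 0))) =
    (0 <= y) && sat S (fcons (h - y) ((x - y *: map_mx ratr v) 0)).
  rewrite /sat /= aval_aff1 rmorph1 rmorph0 mul1r addr0 fcons0; congr (_ && _).
  by rewrite all_map; apply: eq_all => c /=; rewrite substE.
split=> [[y]|[y y0 /SP yS]]; last by exists y; rewrite E y0.
by rewrite E => /andP[y0 /SP yS]; exists y.
Qed.

Lemma ratr_rat (x : rat) : ratr x = x.
Proof. by rewrite /ratr divq_num_den. Qed.

Lemma map_ratr_rat m n (A : 'M[rat]_(m, n)) : map_mx ratr A = A.
Proof. by apply/matrixP => i j; rewrite mxE ratr_rat. Qed.

Lemma aval_ratr (F : realFieldType) n (c : aff n) (x : 'I_n -> rat) :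
  aval c (fun i => ratr (x i) : F) = ratr (aval c x).
Proof.
rewrite /aval rmorphD rmorph_sum ratr_rat; congr (_ + _).
by apply: eq_bigr => i _; rewrite rmorphM ratr_rat.
Qed.

Lemma sat_ratr (F : realFieldType) n (S : seq (aff n)) (x : 'I_n -> rat) :
  sat S (fun i => ratr (x i) : F) = sat S x.
Proof. by apply: eq_all => c; rewrite aval_ratr ler0q. Qed.

(** Both memberships are tested by the same rational system at the same rational point. *)
Lemma conv_at_ratr (F : realFieldType) d (W : seq 'rV[rat]_d) h x :
  conv_at (map (map_mx ratr) W) (ratr h : F) (map_mx ratr x) <-> conv_at W h x.
Proof.
have [S SP] := cone_polyhedral W.
have := SP rat h x; rewrite (eq_map (@map_ratr_rat _ _)) map_id => <-.
rewrite -SP -(sat_ratr F); suff -> : (fun i => ratr (fcons h (x 0) i)) =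
  fcons (ratr h : F) (map_mx ratr x 0) by [].
by apply/funext => i; rewrite /fcons; case: (unlift _ _) => //= j; rewrite mxE.
Qed.

(** * Euler characteristic on the line *)

Definition ineqs (L : seq (rat * rat)) (y : rat) : bool :=
  all (fun c => 0 <= c.1 * y + c.2) L.

Lemma ineqs_convex L x y z : ineqs L x -> ineqs L z -> x <= y <= z -> ineqs L y.
Proof.
move=> /allP Lx /allP Lz /andP[xy yz]; apply/allP => c cL.
have := Lx _ cL; have := Lz _ cL.
have [c0|c0] := leP 0 c.1 => h1 h2; nra.
Qed.

Definition breakpoints (L : seq (rat * rat)) := [seq - c.2 / c.1 | c <- L & c.1 != 0].

(* A constraint can only change sign at a breakpoint. *)
Lemma ineqs_extend L x y : ineqs L x -> x \notin breakpoints L ->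
  (forall z, z \in breakpoints L -> ~~ ((x < z < y) || (y < z < x))) ->
  ineqs L y.
Proof.
move=> /allP Lx xE xy; apply/allP => c cL; have := Lx _ cL.
have [c0|c0] := eqVneq c.1 0; first by rewrite c0 !mul0r.
have zE : - c.2 / c.1 \in breakpoints L.
  by apply: (map_f (fun c => - c.2 / c.1)); rewrite mem_filter c0.
have aE w : c.1 * w + c.2 = c.1 * (w - - c.2 / c.1) by field.
have xz : x != - c.2 / c.1 by apply: contraNneq xE => ->.
move: (xy _ zE); rewrite !aE negb_or; move: xz; set z := - c.2 / c.1 => xz.
move/andP=> [H1 H2].
have [a0|a0|a0] := ltgtP c.1 0; last by rewrite a0 eqxx in c0.
- rewrite !nmulr_rge0 // !subr_le0 le_eqVlt (negbTE xz) /= => xz'.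
  by move: H1; rewrite xz' -leNgt.
- rewrite !pmulr_rge0 // !subr_ge0 le_eqVlt eq_sym (negbTE xz) /= => xz'.
  by move: H2; rewrite xz' andbT -leNgt.
Qed.

(** Cells are signed by dimension: a breakpoint counts [1], a bounded gap, represented by its
    midpoint, counts [-1]. The unbounded gaps carry no weight. *)
Fixpoint chain (e : rat) (E : seq rat) : seq (int * rat) :=
  if E is e' :: E' then (1, e) :: (-1, (e + e') / 2) :: chain e' E' else [:: (1, e)].

(* Euler characteristic of an interval: one more breakpoint than midpoints. *)
Lemma chainP L e E : path <%O e E ->
  {in breakpoints L, forall z, z <= e \/ z \in E} ->
  \sum_(p <- chain e E) p.1 * (ineqs L p.2)%:R = (has (ineqs L) (e :: E))%:R :> int.
Proof.
elim: E e => [|e' E IH] e; first by rewrite /= big_seq1 mul1r orbF.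
move=> /= /andP[ee' eE] LE; rewrite !big_cons IH //=; last first.
  move=> z /LE[ze|]; first by left; apply: ltW; apply: le_lt_trans ee'.
  by rewrite inE => /orP[/eqP->|]; [left|right].
have gap z : z \in breakpoints L -> ~~ (e < z < e').
  move=> /LE[ze|]; first by rewrite ltNge ze.
  rewrite inE => /orP[/eqP->|zE]; first by rewrite ltxx andbF.
  have /allP/(_ _ zE) e'z := order_path_min lt_trans eE.
  by rewrite [_ < e']ltNge (ltW e'z) andbF.
(* No breakpoint lies strictly between [e] and [e'], so the midpoint is feasible exactly when both
   ends are. *)
have mid : ineqs L ((e + e') / 2) = ineqs L e && ineqs L e'.
  apply/idP/andP => [Lm|[Le Le']]; last first.
    by apply: ineqs_convex Le Le' _; lra.
  have mN : (e + e') / 2 \notin breakpoints L.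
    by apply/negP => /gap/negP; apply; lra.
  by split; apply: ineqs_extend Lm mN _ => z /gap; apply: contraNN; lra.
rewrite mid; case: (boolP (ineqs L e')) => [_|Le'].
  by rewrite /= andbT orbT; case: ineqs.
rewrite andbF /= mulr0 add0r; case: (boolP (ineqs L e)) => Le; last by rewrite mulr0 add0r.
rewrite orTb mul1r; suff -> : has (ineqs L) E = false by rewrite addr0.
apply/negbTE; apply: contraNN Le' => /hasP[z zE Lz].
apply: ineqs_convex Le Lz _; rewrite (ltW ee') /=.
by have /allP/(_ _ zE)/ltW := order_path_min lt_trans eE.
Qed.

Lemma euler_line (Ls : seq (seq (rat * rat))) :
  exists s : seq (int * rat), forall L, L \in Ls ->
    \sum_(p <- s) p.1 * (ineqs L p.2)%:R = `[< exists y, ineqs L y >]%:R :> int.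
Proof.
(* Including [0] keeps the list nonempty when no system has a breakpoint. *)
pose E := sort <=%O (undup (0 :: flatten (map breakpoints Ls))).
have Es : sorted <%O E by rewrite lt_sorted_uniq_le sort_uniq undup_uniq sort_le_sorted.
have EL L : L \in Ls -> {subset breakpoints L <= E}.
  move=> LL z zL; rewrite mem_sort mem_undup inE; apply/orP; right.
  by apply/flattenP; exists (breakpoints L) => //; apply: map_f.
have : 0 \in E by rewrite mem_sort mem_undup mem_head.
move: E Es EL => [|e E] // Es EL _; exists (chain e E) => L LL.
rewrite chainP //; last first.
  by move=> z /(EL _ LL); rewrite inE => /orP[/eqP->|]; [left|right].
congr (nat_of_bool _)%:R; apply/hasP/asboolP => [[y _ Ly]|[y Ly]]; first by exists y.
have [yB|yB] := boolP (y \in breakpoints L); first by exists y => //; apply: EL yB.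
case BE : (breakpoints L) => [|z0 B].
  by exists e; rewrite ?mem_head //; apply: ineqs_extend Ly yB _ => z; rewrite BE.
(* The breakpoint nearest to [y] also solves [L], since none lies strictly between them. *)
have [|m mD mP] := @exists_maximum _ [seq - `|z - y| | z <- breakpoints L] (- `|z0 - y|).
  by rewrite BE mem_head.
case/mapP: mD => z zB mE; exists z; first exact: EL zB.
apply: ineqs_extend Ly yB _ => w wB.
have := mP _ (map_f _ wB); rewrite mE lerN2; apply: contraTN; rewrite -ltNge.
case/orP=> /andP[h1 h2].
  by rewrite !gtr0_norm ?subr_gt0 ?ltrD2 //; apply: lt_trans h2.
by rewrite !ltr0_norm ?subr_lt0 ?ltrN2 ?ltrD2 //; apply: lt_trans h2.
Qed.

Definition fiber n (S : seq (aff n.+1)) (x : 'I_n -> rat) : seq (rat * rat) :=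
  [seq (c.1 ord0, aval (aff_tail c) x) | c : aff n.+1 <- S].

Lemma ineqs_fiber n (S : seq (aff n.+1)) x y :
  ineqs (fiber S x) y = sat S (fcons y x).
Proof.
rewrite /ineqs /sat all_map; apply: eq_all => c /=.
by rewrite aval_fcons ratr_rat.
Qed.

(* Integration against the Euler characteristic, realised on a given finite
   family of polyhedra by finitely many weighted rational points. *)
Lemma euler_functional n (Ss : seq (seq (aff n))) :
  exists s : seq (int * ('I_n -> rat)), forall S, S \in Ss ->
    \sum_(p <- s) p.1 * (sat S p.2)%:R = `[< exists x : 'I_n -> rat, sat S x >]%:R :> int.
Proof.
elim: n Ss => [|n IH] Ss.
  exists [:: (1, fun=> 0)] => S _; rewrite big_seq1 mul1r; congr (nat_of_bool _)%:R.
  apply/idP/asboolP => [Sx|[x]]; first by exists (fun=> 0).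
  by congr sat; apply/funext => -[].
have [T TP] : exists T : seq (aff n.+1) -> seq (aff n), forall C (x : 'I_n -> rat),
    sat (T C) x <-> exists y, sat C (fcons y x).
  have [T TP] := choice (@fourier_motzkin n).
  by exists T => C x; apply: TP.
(* A Fubini argument: the functional for the projections leaves finitely many base points, and over
   each of them [euler_line] treats the fibers of all systems at once. *)
have [s sP] := IH (map T Ss).
have {}sP S : S \in Ss -> \sum_(p <- s) p.1 * `[< exists y, sat S (fcons y p.2) >]%:R =
    `[< exists x : 'I_n.+1 -> rat, sat S x >]%:R :> int.
  move=> SS; transitivity (\sum_(p <- s) p.1 * (sat (T S) p.2)%:R).
    apply: eq_bigr => p _; congr (_ * (nat_of_bool _)%:R).
    by apply/asboolP/idP => /TP.
  rewrite sP ?map_f //; congr (nat_of_bool _)%:R; apply/asbool_equiv_eq; split.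
    by case=> x /TP[y yS]; exists (fcons y x).
  case=> x; rewrite (fcons_eta x) => xS.
  by exists (fun i => x (lift ord0 i)); apply/TP; exists (x ord0).
suff [s' s'P] : exists s' : seq (int * ('I_n.+1 -> rat)), forall S, S \in Ss ->
    \sum_(p <- s') p.1 * (sat S p.2)%:R =
    \sum_(p <- s) p.1 * `[< exists y, sat S (fcons y p.2) >]%:R :> int.
  by exists s' => S SS; rewrite s'P // sP.
elim: s {sP} => [|[c x] s [s' s'P]]; first by exists [::] => S _; rewrite !big_nil.
have [t tP] := euler_line [seq fiber C x | C <- Ss].
exists ([seq (c * p.1, fcons p.2 x) | p <- t] ++ s') => S SS.
rewrite big_cat big_cons s'P //; congr (_ + _); rewrite big_map /=.
under eq_bigr do rewrite -ineqs_fiber -mulrA.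
rewrite -mulr_sumr tP; last exact: (map_f (fun C => fiber C x)).
by under eq_exists do rewrite ineqs_fiber.
Qed.

(** * Lattice point counts *)

(** The counting part of [ehr] for an arbitrary set; an infinite set would get the default [0], so
    evaluations go through an enclosing finite list. *)
Definition cnt (T : eqType) (A : set T) : nat := xget 0%N [set n | has_card A n].

Lemma has_card_unique (T : eqType) (A : set T) n m :
  has_card A n -> has_card A m -> n = m.
Proof.
case=> s [su <- sA] [t [tu <- tA]]; apply/perm_size/uniq_perm => // x.
by apply/idP/idP => [/sA/tA|/tA/sA].
Qed.

Lemma cntE (A0 : pzSemiRingType) (T : eqType) (A : set T) (B : seq T) :
  uniq B -> (forall x, A x -> x \in B) ->
  (cnt A)%:R = \sum_(x <- B) `[< A x >]%:R :> A0.
Proof.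
move=> Bu AB; suff -> : cnt A = size [seq x <- B | `[< A x >]].
  by rewrite size_filter -sum1_count natr_sum big_mkcond; apply: eq_bigr => x _; case: asbool.
have hA : has_card A (size [seq x <- B | `[< A x >]]).
  exists [seq x <- B | `[< A x >]]; split; rewrite ?filter_uniq // => x.
  rewrite mem_filter; split=> [/andP[/asboolP]//|Ax].
  by rewrite AB // andbT; apply/asboolP.
by apply: (has_card_unique _ hA); exact: (@xgetPex _ 0%N [set n | has_card A n] (ex_intro _ _ hA)).
Qed.

Lemma cnt_reindex (T : eqType) (f g : T -> T) (A : set T) :
  cancel f g -> cancel g f -> cnt [set x | A (f x)] = cnt A.
Proof.
move=> fK gK; congr xget; apply/seteqP; split=> n [s [su <- sA]].
  exists (map f s); split; rewrite ?map_inj_uniq ?size_map //; first exact: can_inj fK.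
  move=> x; rewrite -{1}[x]gK mem_map; last exact: can_inj fK.
  by rewrite sA /= gK.
exists (map g s); split; rewrite ?map_inj_uniq ?size_map //; first exact: can_inj gK.
move=> x; rewrite -{1}[x]fK mem_map; last exact: can_inj gK.
by rewrite sA /=.
Qed.

Section LatticePoints.
Variables (d : nat).
Implicit Types (W : seq 'rV[rat]_d) (z : 'rV[int]_d) (u w x : 'rV[rat]_d).

Definition toQ z : 'rV[rat]_d := map_mx intr z.

Lemma toQD z1 z2 : toQ (z1 + z2) = toQ z1 + toQ z2.
Proof. exact: map_mxD. Qed.

Lemma toQN z : toQ (- z) = - toQ z.
Proof. exact: map_mxN. Qed.

Lemma toQB z1 z2 : toQ (z1 - z2) = toQ z1 - toQ z2.
Proof. exact: map_mxB. Qed.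

Lemma conv_at_bounded W : exists2 M, 0 <= M & forall h x i, conv_at W h x -> `|x 0 i| <= h * M.
Proof.
elim: W => [|v W [M M0 MP]].
  by exists 0 => // h x i /conv_at_nil[_ ->]; rewrite mxE normr0 mulr0.
exists (M + \sum_i `|v 0 i|); first by rewrite addr_ge0 ?sumr_ge0.
move=> h x i /conv_at_cons[a a0 k]; have := MP _ _ i k; have := conv_at_ge0 k; rewrite !mxE => ha.
have vi : `|v 0 i| <= \sum_i `|v 0 i| by rewrite (bigD1 i) //= lerDl sumr_ge0.
have := ler_normD (x 0 i - a * v 0 i) (a * v 0 i).
rewrite subrK normrM (ger0_norm a0) => h1 h2.
move: (normr_ge0 (v 0 i)) => h3; nra.
Qed.

Lemma lattice_box (K : nat) :
  exists2 B : seq 'rV[int]_d, uniq B & forall z, (forall i, `|z 0 i| <= K%:Z) -> z \in B.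
Proof.
pose f (A : 'rV['I_(2 * K).+1]_d) : 'rV[int]_d := map_mx (fun k => (nat_of_ord k)%:Z - K%:Z) A.
exists (undup [seq f A | A : 'rV['I_(2 * K).+1]_d]); first exact: undup_uniq.
move=> z zK; rewrite mem_undup; apply/fintype.imageP.
exists (\row_i inord `|(z 0 i + K%:Z)%R|%N) => //.
apply/rowP => i; rewrite !mxE.
move: (zK i); move: (z 0 i) => a aK.
rewrite inordK; lia.
Qed.

Lemma conv_at_finite W h w :
  exists2 B : seq 'rV[int]_d, uniq B & forall z, conv_at W h (toQ z - w) -> z \in B.
Proof.
have [M M0 MP] := conv_at_bounded W.
pose r := `|h * M| + \sum_i `|w 0 i|.
have [B Bu BP] := lattice_box (Num.bound r).
exists B => // z /MP H; apply: BP => i; have := H i; rewrite !mxE => Hi.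
have wi : `|w 0 i| <= \sum_i `|w 0 i| by rewrite (bigD1 i) //= lerDl sumr_ge0.
have : (`|z 0 i|%:~R : rat) <= r.
  rewrite intr_norm; have := ler_normD ((z 0 i)%:~R - w 0 i) (w 0 i); rewrite subrK => H1.
  rewrite /r; have := ler_norm (h * M); lra.
move=> zr; have /(le_lt_trans zr) : r < (Num.bound r)%:R.
  by apply: archi_boundP; rewrite addr_ge0 ?sumr_ge0.
by rewrite -[X in _ < X]/((Num.bound r)%:~R) ltr_int => /ltW.
Qed.

(** For [t > 0] one divides by [t]; at [t = 0] both sides describe the origin alone, provided the
    polytope is nonempty. The real count thereby becomes a rational one. *)
Lemma ehr_translate (R : realType) W (t : nat) w : W != [::] ->
  ehr (translate (conv (map (map_mx (@ratr R)) W)) (map_mx ratr w)) t =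
  cnt [set z | conv_at W t%:R (toQ z - t%:R *: w)].
Proof.
move=> W0; congr xget; apply/funext => n /=; congr has_card; apply/funext => z.
have zE : map_mx (fun n : int => n%:~R) z = map_mx ratr (toQ z) :> 'rV[R]_d.
  by apply/rowP => i; rewrite !mxE ratr_int.
rewrite /lattice_pts /dilate /translate /=; apply/propext; rewrite zE; split.
  case=> _ [x Px ->] zx; rewrite -(conv_at_ratr R).
  have -> : map_mx ratr (toQ z - t%:R *: w) = t%:R *: x.
    by rewrite map_mxB zx map_mxZ rmorph_nat scalerDr addrK.
  by have := conv_at_scale (ler0n R t) Px; rewrite mulr1 ratr_nat.
case: t => [|t]; rewrite -(conv_at_ratr R) ratr_nat.
  rewrite scale0r subr0 => /conv_at0 ->.
  case: W W0 => // v W _; exists (map_mx ratr v + map_mx ratr w); last by rewrite scale0r.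
  by exists (map_mx ratr v) => //; apply: conv_at_mem; rewrite mem_head.
move=> k; exists (t.+1%:R^-1 *: map_mx ratr (toQ z - t.+1%:R *: w) + map_mx ratr w).
  exists (t.+1%:R^-1 *: map_mx ratr (toQ z - t.+1%:R *: w)) => //.
  have t0 : 0 <= t.+1%:R^-1 :> R by rewrite invr_ge0 ler0n.
  by have := conv_at_scale t0 k; rewrite mulVf ?pnatr_eq0.
rewrite scalerDr scalerA mulfV ?pnatr_eq0 // scale1r map_mxB map_mxZ rmorph_nat.
by rewrite subrK.
Qed.

End LatticePoints.

(** * Half-integral vertices give symmetric quasi-polynomials *)

Section AlternatingSum.
Variables (d : nat) (W : seq 'rV[rat]_d).
Local Notation m := (size W).
Implicit Types (I : {set 'I_m}) (T : rat) (x : 'rV[rat]_d) (l : 'I_m -> rat).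

(** Adding 2 to the coefficients in [I] realises all shifted dilates as subsets of a single
    polyhedron of coefficient vectors. *)
Lemma conv_at_shift T x I :
  conv_at W (T - 2 * #|I|%:R) (x - \sum_(i in I) 2 *: W`_i) <->
  exists l, [/\ forall i, 2 * (i \in I)%:R <= l i, \sum_i l i = T & x = \sum_i l i *: W`_i].
Proof.
have E1 : \sum_i 2 * (i \in I)%:R = 2 * #|I|%:R :> rat.
  rewrite -mulr_sumr -sum1_card natr_sum [in RHS]big_mkcond; congr (_ * _).
  by apply: eq_bigr => i _; case: (i \in I).
have E2 : \sum_i (2 * (i \in I)%:R) *: W`_i = \sum_(i in I) 2 *: W`_i.
  rewrite [RHS]big_mkcond; apply: eq_bigr => i _.
  by case: (i \in I); rewrite ?mulr1 // mulr0 scale0r.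
split=> [[l [l0 [lT lx]]]|[l [l0 lT lx]]].
  exists (fun i => l i + 2 * (i \in I)%:R); split=> [i||]; first by rewrite lerDr.
    by rewrite big_split /= lT E1 subrK.
  by under eq_bigr do rewrite scalerDl; rewrite big_split /= -lx E2 subrK.
exists (fun i => l i - 2 * (i \in I)%:R); split=> [i|]; first by rewrite subr_ge0.
rewrite sumrB lT E1; split=> //.
by under [RHS]eq_bigr do rewrite scalerBl; rewrite sumrB -lx E2.
Qed.

Definition shift_system T x I : seq (aff m) :=
  [seq aff1 1 i (- (2 * (i \in I)%:R)) | i <- enum 'I_m] ++
  eqns (([ffun=> 1], - T) :: [seq ([ffun i : 'I_m => W`_i 0 j], - x 0 j) | j <- enum 'I_d]).

Lemma shift_systemP T x I l :
  sat (shift_system T x I) l <->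
  [/\ forall i, 2 * (i \in I)%:R <= l i, \sum_i l i = T & x = \sum_i l i *: W`_i].
Proof.
rewrite /sat all_cat -!/(sat _ _) sat_eqns /=; split.
  case/and3P=> /allP H1 /eqP H2 /allP H3; split=> [i||].
  - have := H1 _ (map_f _ (mem_enum _ i)).
    by rewrite aval_aff1 !ratr_rat mul1r subr_ge0.
  - move/eqP: H2; rewrite /aval /= ratr_rat subr_eq0 => /eqP <-.
    by apply: eq_bigr => i _; rewrite ffunE ratr_rat mul1r.
  - apply/rowP => j; have /eqP := H3 _ (map_f _ (mem_enum _ j)).
    rewrite /aval /= ratr_rat => /eqP; rewrite subr_eq0 => /eqP <-.
    by rewrite summxE; apply: eq_bigr => i _; rewrite ffunE ratr_rat mxE mulrC.
case=> H1 H2 H3; apply/and3P; split.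
- by apply/allP => _ /mapP[i _ ->]; rewrite aval_aff1 !ratr_rat mul1r subr_ge0.
- rewrite /aval /= ratr_rat subr_eq0 -H2; apply/eqP.
  by apply: eq_bigr => i _; rewrite ffunE ratr_rat mul1r.
- apply/allP => _ /mapP[j _ ->]; rewrite /aval /= ratr_rat subr_eq0 H3 summxE.
  by apply/eqP; apply: eq_bigr => i _; rewrite ffunE ratr_rat mxE mulrC.
Qed.

Lemma sum_subsets_signed (A : comPzRingType) (n : nat) (b : 'I_n -> A) :
  \sum_(I : {set 'I_n}) (-1) ^+ #|I| * \prod_(i in I) b i = \prod_i (1 - b i).
Proof.
under [RHS]eq_bigr do rewrite addrC.
rewrite bigA_distr; apply: eq_bigr => I _; rewrite -prodrN big_mkcond.
by apply: eq_bigr.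
Qed.

(* For T >= 2m every l >= 0 with sum T has some l_i >= 2, so the polyhedra
   {l_i >= 2 for i in I} satisfy a pointwise inclusion-exclusion identity, and
   the Euler functional turns it into one about their nonemptiness. *)
Lemma conv_at_alternating T x : W != [::] -> 2 * m%:R <= T ->
  \sum_(I : {set 'I_m})
    (-1) ^+ #|I| * `[< conv_at W (T - 2 * #|I|%:R) (x - \sum_(i in I) 2 *: W`_i) >]%:R = 0 :> int.
Proof.
move=> W0 mT; have [s sP] := euler_functional [seq shift_system T x J | J : {set 'I_m}].
transitivity (\sum_(I : {set 'I_m}) (-1) ^+ #|I| *
    \sum_(p <- s) p.1 * (sat (shift_system T x I) p.2)%:R).
  apply: eq_bigr => I _; rewrite sP; last by apply/fintype.imageP; exists I.
  congr (_ * (nat_of_bool _)%:R); apply/asbool_equiv_eq; rewrite conv_at_shift.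
  by split=> -[l] /shift_systemP; exists l.
under eq_bigr do rewrite mulr_sumr.
rewrite exchange_big big1 // => -[c l] _ /=.
under eq_bigr do rewrite mulrCA.
rewrite -mulr_sumr; apply/eqP; rewrite mulf_eq0; apply/orP; right.
have E I : (sat (shift_system T x I) l)%:R =
   (sat (shift_system T x finset.set0) l)%:R * \prod_(i in I) (2 <= l i)%R%:R :> int.
  have -> : \prod_(i in I) (2 <= l i)%R%:R = [forall (i | i \in I), (2 <= l i)%R]%:R :> int.
    case: (boolP [forall (i | i \in I), 2 <= l i]) => [/forall_inP H|/forall_inPn[i iI /negbTE Hi]].
      by apply: big1 => i /H ->.
    by rewrite (bigD1 i) //= Hi mul0r.
  rewrite -natrM mulnb; congr (nat_of_bool _)%:R.
  apply/idP/andP => [/shift_systemP[H1 H2 H3]|[/shift_systemP[H1 H2 H3] /forall_inP H4]].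
    split; first apply/shift_systemP; first split=> // i.
      by rewrite inE mulr0; apply: le_trans (H1 i); rewrite mulr_ge0.
    by apply/forall_inP => i iI; move: (H1 i); rewrite iI mulr1.
  apply/shift_systemP; split=> // i; case: (boolP (i \in I)) => [/H4|_]; first by rewrite mulr1.
  by move: (H1 i); rewrite inE.
under eq_bigr do rewrite E mulrCA.
(* At a fixed [l] the signed sum factors into the terms [1 - [2 <= l i]], so one coefficient that is
   at least 2 makes it vanish. *)
rewrite -mulr_sumr sum_subsets_signed mulf_eq0 -implyNb; apply/implyP.
rewrite pnatr_eq0 eqb0 negbK => /shift_systemP[l0 lT _].
(* If all coefficients were below 2, their sum [T] would be below [2 m]. *)
case: (boolP [exists i, 2 <= l i]) => [/existsP[i li]|/existsPn H].
  by rewrite (bigD1 i) //= li subrr mul0r.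
have : \sum_i l i < \sum_(i < m) 2.
  have i0 : 'I_m by case: (W) W0 => // *; exact: ord0.
  by apply: ltr_sum => [|i _]; [apply/hasP; exists i0; rewrite ?mem_index_enum|rewrite ltNge].
by rewrite lT sumr_const card_ord -[_ *+ m]mulr_natr ltNge mT.
Qed.

End AlternatingSum.

(** * Finite differences and interpolation *)

Definition fdiff (h : nat -> int) (s : nat) : int := h s.+1 - h s.

Lemma iter_fdiff_binomial m (h : nat -> int) s :
  \sum_(j < m.+1) (-1) ^+ j * ('C(m, j))%:R * h (s + (m - j))%N = iter m fdiff h s.
Proof.
elim: m h s => [|m IH] h s; first by rewrite big_ord1 !mul1r addn0.
rewrite iterSr -IH; under [RHS]eq_bigr do rewrite /fdiff mulrBr.
rewrite sumrB [LHS]big_ord_recl /= bin0 mulr1 mul1r subn0.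
under eq_bigr do rewrite /bump leq0n add1n binS subSS natrD mulrDr mulrDl.
rewrite big_split /= addrA; congr (_ + _); last first.
  by rewrite -sumrN; apply: eq_bigr => j _; rewrite exprS mulN1r !mulNr.
transitivity (\sum_(j < m.+2) (-1) ^+ j * ('C(m, j))%:R * h (s + (m.+1 - j))%N).
  by rewrite [RHS]big_ord_recl /= bin0 mulr1 mul1r subn0.
rewrite big_ord_recr /= bin_small // mulr0 mul0r addr0.
apply: eq_bigr => j _; have jm : (j <= m)%N := ltn_ord j.
by rewrite subSn // addnS.
Qed.

Lemma iter_fdiff_subsets m (h : nat -> int) s :
  \sum_(I : {set 'I_m}) (-1) ^+ #|I| * h (s + (m - #|I|))%N = iter m fdiff h s.
Proof.
rewrite -iter_fdiff_binomial.
have Im (I : {set 'I_m}) : (#|I| < m.+1)%N by rewrite ltnS -[X in (_ <= X)%N]card_ord max_card.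
rewrite (partition_big (fun I : {set 'I_m} => Ordinal (Im I)) predT) //=.
apply: eq_bigr => j _.
transitivity (\sum_(I : {set 'I_m} | #|I| == j) (-1) ^+ j * h (s + (m - j))%N).
  rewrite (eq_bigl (fun I : {set 'I_m} => #|I| == j)) //.
  by apply: eq_bigr => I /eqP ->.
rewrite sumr_const mulrAC mulr_natr; congr (_ *+ _).
have := card_draws 'I_m j; rewrite card_ord => <-; rewrite cardsE.
by [].
Qed.

(** Newton's series, finite because the [m]-th difference vanishes: the case [m - 1] applies to the
    first difference, and Pascal's rule sums it up in [s]. *)
Lemma newton_forward m (h : nat -> int) : (forall s, iter m fdiff h s = 0) ->
  forall s, h s = \sum_(j < m) iter j fdiff h 0%N * ('C(s, j))%:R.
Proof.
elim: m h => [|m IH] h H s; first by rewrite big_ord0 -(H s).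
elim: s => [|s IHs].
  rewrite big_ord_recl bin0 mulr1 big1 ?addr0 // => j _.
  by rewrite bin0n mulr0.
have -> : h s.+1 = h s + fdiff h s by rewrite /fdiff addrC subrK.
rewrite (IH (fdiff h)) => [|k]; last by rewrite -iterSr H.
rewrite IHs !big_ord_recl !bin0 -addrA; congr (_ + _).
rewrite -big_split; apply: eq_bigr => j _ /=.
by rewrite /bump leq0n add1n -iterSr -mulrDr binS natrD.
Qed.

(** The binomial coefficient [C(X, j)] as a polynomial in its upper argument. *)
Fixpoint binomial_poly (R : realType) (j : nat) : {poly R} :=
  if j is j'.+1 then j%:R^-1 *: (binomial_poly R j' * ('X - j'%:R%:P)) else 1.

Lemma binomial_polyE (R : realType) j s : (binomial_poly R j).[s%:R] = ('C(s, j))%:R.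
Proof.
elim: j => [|j IH] /=; first by rewrite hornerC bin0.
rewrite hornerZ hornerM IH hornerXsubC; apply: (mulfI (_ : j.+1%:R != 0)).
  by rewrite pnatr_eq0.
rewrite mulVKf ?pnatr_eq0 // -natrM mul_bin_left.
have [sj|js] := ltnP s j; last by rewrite natrM natrB // mulrC.
by rewrite bin_small // mul0r (eqP (ltnW sj : (s - j == 0)%N)) mul0n.
Qed.

(** Chosen from [h] alone, so that equal counting functions yield equal constituents. *)
Definition interpolant (R : realType) (h : nat -> nat) : {poly R} :=
  xget 0 [set p | forall s, (h s)%:R = p.[s%:R]].

Lemma interpolantE (R : realType) m (h : nat -> nat) :
  (forall s, \sum_(I : {set 'I_m}) (-1) ^+ #|I| * (h (s + (m - #|I|))%N)%:R = 0 :> int) ->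
  forall s, (h s)%:R = (interpolant R h).[s%:R].
Proof.
move=> H; pose h' s : int := (h s)%:R.
pose p : {poly R} := \sum_(j < m) (iter j fdiff h' 0%N)%:~R *: binomial_poly R j.
apply: (@xgetPex _ 0 [set p : {poly R} | forall s, (h s)%:R = p.[s%:R]]).
exists p => s; transitivity ((h' s)%:~R : R); first by rewrite rmorph_nat.
rewrite (@newton_forward m h') => [|k]; last by rewrite -iter_fdiff_subsets H.
rewrite horner_sum rmorph_sum; apply: eq_bigr => j _ /=.
by rewrite hornerZ binomial_polyE rmorphM rmorph_nat.
Qed.

Section Counting.
Variables (d : nat) (W : seq 'rV[rat]_d).
Implicit Types (u w x : 'rV[rat]_d) (t : nat).

(** Lattice points of [tP + u]. The shift is independent of [t]; the Ehrhart function of [P + w] is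
    the case [u = t w]. *)
Definition shifted_count t u : nat := cnt [set z | conv_at W t%:R (toQ z - u)].

Lemma shifted_count_lattice t u z0 : shifted_count t (u + toQ z0) = shifted_count t u.
Proof.
rewrite /shifted_count -[RHS](@cnt_reindex _ (fun z => z - z0) (fun z => z + z0)) => [|z|z].
- by congr cnt; apply/funext => z /=; rewrite toQB opprD addrA addrAC.
- exact: subrK.
- exact: addrK.
Qed.

Lemma conv_at_opp (h : rat) x : (forall w, w \in W -> conv_at W 1 (- w)) ->
  conv_at W h x -> conv_at W h (- x).
Proof.
move=> WN [l [l0 [lh ->]]]; apply: (@conv_at_sub _ _ (map -%R W)).
  by move=> _ /mapP[v vW ->]; apply: WN.
rewrite -lh; elim: W l l0 {WN lh} => [|v V IH] l l0; first by rewrite !big_ord0 oppr0; apply/conv_at0.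
apply/conv_at_cons; exists (l ord0); first exact: l0.
rewrite !big_ord_recl /= [l ord0 + _]addrC addrK opprD scalerN opprK addrAC addNr add0r.
exact: IH.
Qed.

Lemma shifted_count_opp t u : (forall w, w \in W -> conv_at W 1 (- w)) ->
  shifted_count t (- u) = shifted_count t u.
Proof.
move=> WN; rewrite /shifted_count -[RHS](@cnt_reindex _ -%R -%R); try exact: opprK.
congr cnt; apply/funext => z /=; apply/propext.
by rewrite toQN opprK -opprD; split=> /(conv_at_opp WN); rewrite ?opprK.
Qed.

(** Translation by the lattice points [2 w_i] preserves counts, so each term counts a subset of one
    [tP + u], and the pointwise alternating identity can be summed over its lattice points. *)
Lemma shifted_count_recurrence b u s : W != [::] ->
  (forall w, w \in W -> exists z, 2 *: w = toQ z) ->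
  \sum_(I : {set 'I_(size W)}) (-1) ^+ #|I| *
    (shifted_count (2 * (s + (size W - #|I|)) + b) u)%:R = 0 :> int.
Proof.
move=> W0 WZ; set m := size W; pose t := (2 * (s + m) + b)%N.
pose A (I : {set 'I_m}) : set 'rV[int]_d := [set z |
  conv_at W (t%:R - 2 * #|I|%:R) (toQ z - u - \sum_(i in I) 2 *: W`_i)]%classic.
have tE (I : {set 'I_m}) : (2 * (s + (m - #|I|)) + b)%:R = t%:R - 2 * #|I|%:R :> rat.
  have Im : (#|I| <= m)%N by rewrite -[X in (_ <= X)%N]card_ord max_card.
  rewrite /t natrD natrM natrD natrB // [in RHS]natrD [in RHS]natrM [in RHS]natrD.
  ring.
have AE (I : {set 'I_m}) : shifted_count (2 * (s + (m - #|I|)) + b) u = cnt (A I).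
  have [z zE] : exists z, \sum_(i in I) 2 *: W`_i = toQ z.
    apply: (big_ind (fun x => exists z, x = toQ z)).
    - by exists 0; rewrite /toQ map_mx0.
    - by move=> _ _ [y ->] [z ->]; exists (y + z); rewrite toQD.
    - by move=> i _; apply/WZ/mem_nth.
  rewrite -(shifted_count_lattice _ _ z) /shifted_count tE; congr cnt.
  by apply/funext => y; rewrite /A /= zE opprD addrA.
have [B Bu BP] := conv_at_finite W t%:R u.
have AB (I : {set 'I_m}) z : A I z -> z \in B.
  rewrite /A /= conv_at_shift => -[l [l0 lt lx]]; apply: BP.
  exists l; split=> // i; apply: le_trans (l0 i).
  by rewrite mulr_ge0.
under eq_bigr do rewrite AE (cntE _ Bu (@AB _)) mulr_sumr.
rewrite exchange_big big1 // => z _; apply: conv_at_alternating => //.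
by rewrite /t natrD natrM natrD mulrDr -addrA addrCA lerDl addr_ge0 ?mulr_ge0.
Qed.

End Counting.

Lemma rational_denominator d (w : 'rV[rat]_d) :
  exists2 D : nat, (0 < D)%N & exists z, D%:R *: w = toQ z.
Proof.
pose D := (\prod_i `|denq (w 0%R i)|)%N.
exists D; first by rewrite prodn_gt0 // => i; rewrite absz_gt0 denq_neq0.
exists (\row_i (numq (w 0 i) * (\prod_(j | j != i) `|denq (w 0%R j)|)%N%:Z)).
apply/rowP => i; rewrite !mxE /D (bigD1 i) //= natrM intrM mulrAC; congr (_ * _).
have -> : `|denq (w 0%R i)|%N%:R = (denq (w 0 i))%:~R :> rat.
  by rewrite -[in RHS](gtz0_abs (denq_gt0 _)).
by rewrite mulrC numqE.
Qed.

Lemma symmetric_translates (R : realType) d (W : seq 'rV[rat]_d) w :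
  W != [::] ->
  (forall w, w \in W -> conv_at W 1 (- w)) ->
  (forall w, w \in W -> exists z, 2 *: w = toQ z) ->
  symmetric_qp R (ehr (translate (conv (map (map_mx (@ratr R)) W)) (map_mx ratr w))).
Proof.
move=> W0 WN WZ; have [D D0 [zD zDE]] := rational_denominator w.
(* The residue modulo [N] fixes the parity of [t] and, as [N w] is a lattice point, the class of
   [t w] modulo the lattice. *)
pose N := (2 * D)%N.
pose h k s := shifted_count W (2 * s + k %% 2) (k%:R *: w).
(* The substitution recovers [s] from [t = 2 s + k %% 2]. *)
pose p k : {poly R} := interpolant R (h k) \Po (2^-1 *: ('X - (k %% 2)%N%:R%:P)).
have NE : N%:R *: w = toQ (zD + zD) by rewrite /N natrM -scalerA zDE toQD scaler_nat mulr2n.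
have hmod k n q : shifted_count W n ((q * N + k)%:R *: w) = shifted_count W n (k%:R *: w).
  elim: q => // q <-; rewrite mulSn -addnA natrD scalerDl NE addrC.
  exact: shifted_count_lattice.
exists N, p; split; [split|].
- by rewrite muln_gt0.
- move=> t; rewrite ehr_translate // -/(shifted_count W t (t%:R *: w)).
  have -> : shifted_count W t (t%:R *: w) = h (t %% N)%N (t %/ 2)%N.
    rewrite /h modn_dvdm ?dvdn_mulr // [(2 * _)%N]mulnC -divn_eq.
    by rewrite {2}(divn_eq t N) hmod.
  rewrite (@interpolantE _ (size W)) => [|s]; last exact: shifted_count_recurrence.
  rewrite /p horner_comp; congr (_.[_]).
  rewrite hornerZ hornerXsubC modn_dvdm ?dvdn_mulr // {2}(divn_eq t 2) natrD natrM.
  by field.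
move=> k kN; case: k kN => [|k] kN; first by rewrite subn0 modnn.
rewrite modn_small ?ltn_subrL ?muln_gt0 //.
have k2 : ((N - k.+1) %% 2 = k.+1 %% 2)%N by lia.
rewrite /p k2; congr (interpolant R _ \Po _); apply/funext => s; rewrite /h k2.
(* Opposite residues give shifts that are opposite up to the lattice point [N w], and the count is
   even in the shift. *)
rewrite -shifted_count_opp // natrB 1?ltnW // scalerBl NE.
by rewrite -scaleNr -[in RHS]addrC shifted_count_lattice scaleNr.
Qed.

(** * Symmetric quasi-polynomials force half-integral vertices *)

Lemma small_scale (xs : seq rat) (r : rat) : 0 < r ->
  exists2 s, 0 < s & forall x, x \in xs -> s * `|x| < r.
Proof.
move=> r0; have x1 : 0 < 1 + \sum_(x <- xs) `|x| by rewrite ltr_pwDl ?sumr_ge0.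
exists (r / (1 + \sum_(x <- xs) `|x|)) => [|x xxs]; first exact: divr_gt0.
rewrite mulrAC ltr_pdivrMr // ltr_pM2l //.
by rewrite (big_rem x xxs) /= addrCA ltrDl ltr_pwDl ?sumr_ge0.
Qed.

Lemma common_denominator (xs : seq rat) :
  exists2 D : nat, (0 < D)%N & forall x, x \in xs -> D%:R * x \is a Num.int.
Proof.
elim: xs => [|y xs [D D0 DP]]; first by exists 1%N.
exists (D * `|denq y|)%N; first by rewrite muln_gt0 D0 absz_gt0 denq_neq0.
move=> x; rewrite natrM inE => /orP[/eqP->|/DP Dx]; last first.
  by rewrite mulrAC rpredM ?natr_int.
have -> : `|denq y|%N%:R = (denq y)%:~R :> rat by rewrite -[in RHS](gtz0_abs (denq_gt0 _)).
by rewrite -mulrA [_ * y]mulrC -numqE rpredM ?natr_int ?intr_int.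
Qed.

Section VertexDetection.
Variables (d : nat) (W : seq 'rV[rat]_d) (S : seq (aff d.+1)).
Implicit Types (c : aff d.+1) (h t s : rat) (x y v e : 'rV[rat]_d).
Hypothesis SP : forall h x, sat S (fcons h (x 0)) <-> conv_at W h x.

Definition slack c h x : rat := aval c (fcons h (x 0)).
Definition slope c e : rat := \sum_i c.1 (lift ord0 i) * e 0 i.

Lemma slackD c h x e : slack c h (x + e) = slack c h x + slope c e.
Proof.
rewrite /slack /slope !aval_fcons /aval -addrA; congr (_ + _).
rewrite addrAC -big_split; congr (_ + _); apply: eq_bigr => i _ /=.
by rewrite mxE mulrDr ffunE !ratr_rat.
Qed.

Lemma slopeZ c s e : slope c (s *: e) = s * slope c e.
Proof. by rewrite /slope mulr_sumr; apply: eq_bigr => i _; rewrite mxE mulrCA. Qed.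

Lemma slopeN c e : slope c (- e) = - slope c e.
Proof. by rewrite -scaleN1r slopeZ mulN1r. Qed.

Lemma conv_at_slack h x : conv_at W h x <-> forall c, c \in S -> 0 <= slack c h x.
Proof. by rewrite -SP; split=> [/allP|H]; last apply/allP. Qed.

Definition tight h x : seq (aff d.+1) := [seq c <- S | slack c h x == 0].

(* The sum of the constraints tight at v vanishes on P only at v. *)
Definition descent v e : rat := \sum_(c <- tight 1 v) slope c e.

Lemma descentZ v s e : descent v (s *: e) = s * descent v e.
Proof. by rewrite /descent mulr_sumr; apply: eq_bigr => c _; rewrite slopeZ. Qed.

Lemma step_bound h x e : exists2 s, 0 < s &
  forall c, c \in S -> slack c h x != 0 -> s * `|slope c e| < `|slack c h x|.
Proof.
have [s s0 sP] := @small_scale [seq slope c e / slack c h x | c <- S] 1 ltr01.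
exists s => // c cS c0; have := sP _ (map_f _ cS).
by rewrite normrM normfV mulrA ltr_pdivrMr ?normr_gt0 // mul1r.
Qed.

(** Loose constraints survive because the step is short, tight ones because their slope is
    nonnegative. *)
Lemma feasible_step h x e s : 0 < s -> conv_at W h x ->
  (forall c, c \in S -> slack c h x != 0 -> s * `|slope c e| < `|slack c h x|) ->
  (forall c, c \in tight h x -> 0 <= slope c e) -> conv_at W h (x + s *: e).
Proof.
move=> s0 /conv_at_slack kx sP eP; apply/conv_at_slack => c cS; rewrite slackD slopeZ.
have [c0|c0] := eqVneq (slack c h x) 0.
  by rewrite c0 add0r mulr_ge0 ?(ltW s0) // eP // mem_filter c0 eqxx.
have := sP _ cS c0; rewrite (ger0_norm (kx _ cS)).
have := ler_norm (- slope c e); rewrite normrN; nra.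
Qed.

Lemma map_ratr_inj (R : realType) : injective (map_mx (@ratr R) : 'rV_d -> 'rV_d).
Proof. by move=> x y /rowP xy; apply/rowP => i; have := xy i; rewrite !mxE => /fmorph_inj. Qed.

(** If all tight slopes vanished along [y - v], short steps from [v] in both directions would stay
    in [P], making [v] a proper midpoint. *)
Lemma descent_gt0 (R : realType) v y :
  is_vertex (conv (map (map_mx (@ratr R)) W)) (map_mx ratr v) ->
  conv_at W 1 y -> y != v -> 0 < descent v (y - v).
Proof.
have KE x : conv (map (map_mx (@ratr R)) W) (map_mx ratr x) <-> conv_at W 1 x.
  by rewrite -(conv_at_ratr R) rmorph1.
move=> [/KE kv vx] ky yv.
have ge0 c : c \in tight 1 v -> 0 <= slope c (y - v).
  rewrite mem_filter => /andP[/eqP c0 cS].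
  have := (conv_at_slack 1 y).1 ky _ cS.
  by rewrite -{1}[y](subrK v) addrC slackD c0 add0r.
rewrite lt_neqAle eq_sym; apply/andP; split; last by rewrite /descent big_seq sumr_ge0.
apply: contra_neqN yv; rewrite /descent big_seq psumr_eq0 // => /allP H.
have eq0 c : c \in tight 1 v -> slope c (y - v) = 0.
  by move=> cT; apply/eqP; have /implyP := H _ cT; apply.
have [s s0 sP] := step_bound 1 v (y - v).
have k1 : conv_at W 1 (v + s *: (y - v)) by apply: feasible_step.
have k2 : conv_at W 1 (v - s *: (y - v)).
  rewrite -scalerN; apply: feasible_step => // c cS; rewrite slopeN ?normrN; first exact: sP.
  by rewrite eq0 ?oppr0.
have l12 : (0 < 2^-1 :> R) && (2^-1 < 1 :> R).
  by apply/andP; split; rewrite ?invr_gt0 ?invf_lt1 ?ltr0n ?ltr1n.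
have := vx _ _ ((KE _).2 k1) ((KE _).2 k2) _ l12.
have -> : 1 - 2^-1 = 2^-1 :> R by field.
rewrite -scalerDr -map_mxD.
have -> : v + s *: (y - v) + (v - s *: (y - v)) = 2%:R *: v.
  by rewrite addrACA subrr addr0 scaler_nat mulr2n.
rewrite map_mxZ rmorph_nat scalerA mulVf ?pnatr_eq0 // scale1r => /(_ erefl)/map_ratr_inj/addrI.
move/eqP; rewrite -subr_eq0 opprK -mulr2n -scaler_nat !scaler_eq0 pnatr_eq0 (gt_eqF s0) /=.
by rewrite subr_eq0 => /eqP.
Qed.

Definition slopes (J : seq (aff d.+1)) : seq (aff d) :=
  [seq ([ffun i => c.1 (lift ord0 i)], 0) | c : aff d.+1 <- J].

(** Normalising to [descent v e = -1] replaces the strict condition [descent v e < 0] on directions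
    by an equation. *)
Definition descent_eqn v : aff d := ([ffun i => \sum_(c <- tight 1 v) c.1 (lift ord0 i)], 1).

Lemma sat_slopes J (f : 'I_d -> rat) :
  sat (slopes J) f = all (fun c => 0 <= slope c (\row_i f i)) J.
Proof.
rewrite /sat all_map; apply: eq_all => c /=; congr (0 <= _).
rewrite /aval rmorph0 addr0; apply: eq_bigr => i _.
by rewrite mxE ffunE ratr_rat.
Qed.

Lemma sat_descent_eqn v (f : 'I_d -> rat) :
  sat (eqns [:: descent_eqn v]) f = (descent v (\row_i f i) == -1).
Proof.
rewrite sat_eqns /= andbT /aval rmorph1 -[X in _ = (_ == X)]add0r -subr_eq opprK.
congr (_ + _ == 0); rewrite /descent exchange_big; apply: eq_bigr => i _ /=.
by rewrite ffunE ratr_rat mulr_suml; apply: eq_bigr => c _; rewrite mxE.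
Qed.

(** All these slacks are multiples of [1 / D] for a common denominator [D]. The bound is uniform in
    [t] and [z], so one shift size can serve every dilate. *)
Lemma slack_gap v : exists2 r, 0 < r & forall (t : nat) z c, c \in S ->
  slack c t%:R (toQ z + v) != 0 -> r <= `|slack c t%:R (toQ z + v)|.
Proof.
have [D D0 DP] := common_denominator
  (flatten [seq slack c 0 v :: [seq c.1 i | i <- enum 'I_d.+1] | c : aff d.+1 <- S]).
have D0' : 0 < D%:R :> rat by rewrite ltr0n.
exists D%:R^-1 => [|t z c cS]; first by rewrite invr_gt0.
have Dc i : D%:R * c.1 i \is a Num.int.
  apply: DP; apply/flattenP; exists (slack c 0 v :: [seq c.1 i | i <- enum 'I_d.+1]).
    exact: (map_f (fun c : aff d.+1 => slack c 0 v :: [seq c.1 i | i <- enum 'I_d.+1])).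
  by rewrite inE map_f ?mem_enum ?orbT.
have Dv : D%:R * slack c 0 v \is a Num.int.
  apply: DP; apply/flattenP; exists (slack c 0 v :: [seq c.1 i | i <- enum 'I_d.+1]).
    exact: (map_f (fun c : aff d.+1 => slack c 0 v :: [seq c.1 i | i <- enum 'I_d.+1])).
  exact: mem_head.
have : D%:R * slack c t%:R (toQ z + v) \is a Num.int.
  have -> : slack c t%:R (toQ z + v) = c.1 ord0 * t%:R + slack c 0 v + slope c (toQ z).
    rewrite addrC slackD /slack !aval_fcons mulr0 add0r; congr (_ * _ + _ + _).
    exact: ratr_rat.
  rewrite mulrDr (mulrDr _ (_ * _)); apply: rpredD; first apply: rpredD => //.
    by rewrite mulrA; apply: rpredM; rewrite ?natr_int.
  rewrite /slope mulr_sumr; apply: rpred_sum => i _; rewrite mulrA; apply: rpredM => //.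
  by rewrite mxE intr_int.
move=> Di c0; have := norm_intr_ge1 Di; rewrite mulf_neq0 ?(lt0r_neq0 D0') // => /(_ isT).
by rewrite normrM (gtr0_norm D0') -ler_pdivrMl // mulr1.
Qed.

(* Near x the polytope tP agrees with the cone cut out by the constraints tight
   at x, and no direction of that cone decreases [descent v] exactly when x is
   the vertex tv. *)
Lemma vertex_functional (R : realType) v :
  is_vertex (conv (map (map_mx (@ratr R)) W)) (map_mx ratr v) ->
  exists2 L : seq (int * 'rV[rat]_d), (1, 0) \in L &
    forall (t : nat) z, (0 < t)%N ->
      \sum_(p <- L) p.1 * `[< conv_at W t%:R (toQ z + v + p.2) >]%:R =
      (toQ z + v == t%:R *: v)%:R :> int.
Proof.
move=> vx; pose dirs J := slopes J ++ eqns [:: descent_eqn v].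
(* The tight constraints vary with [t] and [z], so the functional is built for all subsets of [S] at
   once. *)
have [s sP] := euler_functional [seq dirs (mask b S) | b : (size S).-tuple bool].
pose row (f : 'I_d -> rat) : 'rV[rat]_d := \row_i f i.
have [r r0 rP] := slack_gap v.
have [q q0 qP] := @small_scale [seq slope c (row p.2) | c <- S, p <- s] r r0.
(* The sum will be [[x in tP]] times one minus the Euler characteristic of the set of tight
   directions with descent [-1]. *)
exists ((1, 0) :: [seq (- p.1, q *: row p.2) | p <- s & descent v (row p.2) == -1]).
  exact: mem_head.
move=> t z t0; set x := toQ z + v.
have tQ : 0 < t%:R :> rat by rewrite ltr0n.
have dirsE J f : sat (dirs J) f =
    all (fun c => 0 <= slope c (row f)) J && (descent v (row f) == -1).
  by rewrite /sat all_cat -!/(sat _ _) sat_slopes sat_descent_eqn.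
(* The shift changes each slack by less than the gap [r], so nonzero slacks keep their sign and only
   the tight constraints matter. *)
have nearE p : p \in s -> `[< conv_at W t%:R (x + q *: row p.2) >] =
    `[< conv_at W t%:R x >] && all (fun c => 0 <= slope c (row p.2)) (tight t%:R x).
  move=> ps; have small c : c \in S -> q * `|slope c (row p.2)| < r.
    by move=> cS; apply: qP; apply/allpairsP; exists (c, p).
  have bnd c : - `|slope c (row p.2)| <= slope c (row p.2) <= `|slope c (row p.2)|.
    by rewrite -ler_norml.
  apply/asboolP/andP => [/conv_at_slack H|[/asboolP kx /allP H]].
    split; first apply/asboolP/conv_at_slack => c cS.
      have := H _ cS; rewrite slackD slopeZ => H1; rewrite leNgt; apply/negP => cn.
      have := rP t z c cS (ltr0_neq0 cn); rewrite -/x (ltr0_norm cn) => H2.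
      have := small _ cS; have := bnd c => /andP[_ h1] h2; nra.
    apply/allP => c; rewrite mem_filter => /andP[/eqP c0 /H].
    by rewrite slackD c0 add0r slopeZ pmulr_rge0.
  apply: feasible_step => // c cS c0.
  by apply: lt_le_trans (small _ cS) _; apply: rP.
rewrite big_cons mul1r addr0 big_map /=.
have -> : \sum_(p <- [seq p <- s | (descent v (row p.2) == -1)%R])
    - p.1 * `[< conv_at W t%:R (x + q *: row p.2) >]%:R =
    - (`[< conv_at W t%:R x >]%:R *
       `[< exists f : 'I_d -> rat, sat (dirs (tight t%:R x)) f >]%:R) :> int.
  rewrite -sP; last first.
    apply/fintype.imageP; rewrite /tight filter_mask.
    by exists (map_tuple (fun c => slack c t%:R x == 0) (in_tuple S)).
  rewrite big_filter mulr_sumr -sumrN big_mkcond /=; apply: eq_big_seq => p ps.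
  rewrite nearE // dirsE; case: eqP => _; rewrite ?andbT ?andbF ?mulr0 ?oppr0 //.
  by rewrite mulNr -mulnb natrM mulrCA.
have kv : conv_at W t%:R (t%:R *: v).
  have kv1 : conv_at W 1 v by case: vx => + _; rewrite -(conv_at_ratr R) rmorph1.
  by have := conv_at_scale (ltW tQ) kv1; rewrite mulr1.
have far y : conv_at W t%:R y -> y != t%:R *: v -> 0 < descent v (y - t%:R *: v).
  move=> ky yv; rewrite -(@pmulr_rgt0 _ t%:R^-1) ?invr_gt0 // -descentZ scalerBr.
  rewrite scalerA mulVf ?gt_eqF // scale1r; apply: (descent_gt0 vx).
    have ti0 : 0 <= t%:R^-1 :> rat by rewrite invr_ge0 ltW.
    by have := conv_at_scale ti0 ky; rewrite mulVf ?gt_eqF.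
  by apply: contra_neq yv => <-; rewrite scalerA mulfV ?gt_eqF // scale1r.
case: (asboolP (conv_at W t%:R x)) => kx; last first.
  rewrite mul0r subr0; case: eqP => // xv; case: kx; by rewrite xv.
(* At [tv] such a direction would lead to a point of [tP] with [descent v] below its minimum;
   elsewhere in [tP] one exists. *)
rewrite mul1r; case: eqP => [xv|/eqP xv].
  case: asboolP => [[f]|_]; last by rewrite subr0.
  rewrite dirsE => /andP[/allP H1 /eqP H2].
  have [w w0 wP] := step_bound t%:R x (row f).
  have ne : t%:R *: v + w *: row f != t%:R *: v.
    rewrite -subr_eq0 addrAC subrr add0r scaler_eq0 (gt_eqF w0) /=.
    apply/eqP => f0; move: H2; rewrite f0 -(scale0r 0) descentZ mul0r => /esym/eqP.
    by rewrite oppr_eq0 oner_eq0.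
  have := far _ (feasible_step w0 kx wP H1); rewrite xv => /(_ ne).
  by rewrite [_ + _ - _]addrAC subrr add0r descentZ H2 mulrN1 oppr_gt0 ltNge ltW.
case: asboolP => [_|[]]; first by rewrite subrr.
have pos := far _ kx xv; set a := descent v _ in pos.
(* The direction from [x] towards [tv], scaled to descent [-1]. *)
pose e := a^-1 *: (t%:R *: v - x).
have rowE : row (e 0) = e by apply/rowP => i; rewrite mxE.
exists (e 0); rewrite dirsE rowE; apply/andP; split.
  apply/allP => c; rewrite mem_filter => /andP[/eqP c0 cS].
  rewrite slopeZ mulr_ge0 ?invr_ge0 ?(ltW pos) //.
  have := (conv_at_slack _ _).1 kv _ cS.
  by rewrite -{1}[t%:R *: v](subrK x) addrC slackD c0 add0r.
by rewrite descentZ -opprB -scaleN1r descentZ -/a mulN1r mulrN mulVf ?(gt_eqF pos).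
Qed.

End VertexDetection.

Lemma poly_constant_on_progression (R : realType) (q : {poly R}) (M : nat) (a : R) : (0 < M)%N ->
  (forall j, q.[(j * M + 1)%:R] = a) -> q = a%:P.
Proof.
move=> M0 qa; apply/eqP; rewrite -subr_eq0; apply/negPn/negP => q0.
pose rs : seq R := [seq (j * M + 1)%:R | j <- iota 0 (size (q - a%:P))].
have rsq : all (root (q - a%:P)) rs.
  apply/allP => _ /mapP[j _ ->]; by rewrite /root hornerD hornerN hornerC qa subrr.
have rsu : uniq rs.
  rewrite map_inj_uniq ?iota_uniq // => i j /eqP.
  by rewrite eqr_nat eqn_add2r eqn_pmul2r // => /eqP.
by have := max_poly_roots q0 rsq rsu; rewrite size_map size_iota ltnn.
Qed.

Section SymmetricCounts.
Variables (R : realType) (d : nat) (W : seq 'rV[rat]_d).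
Hypothesis W0 : W != [::].
Hypothesis WN : forall w, w \in W -> conv_at W 1 (- w).
Hypothesis symP : forall w : 'rV[rat]_d,
  symmetric_qp R (ehr (translate (conv (map (map_mx (@ratr R)) W)) (map_mx ratr w))).
Implicit Types (w v : 'rV[rat]_d).

(* Modulo a multiple of the denominator of w the dilate t(P + w) is a lattice
   translate of tP + w for t = 1 and of tP - w for t = -1, and these two have
   equally many lattice points. *)
Lemma common_constituent w : exists2 N : nat, (0 < N)%N & exists q : {poly R},
  forall M j t : nat, (0 < M)%N -> (N %| M)%N -> (t = j * M + 1 \/ t = j * M + (M - 1))%N ->
    q.[t%:R] = (shifted_count W t w)%:R.
Proof.
have [D D0 [z zE]] := rational_denominator w.
have [N [p [[N0 pE] pS]]] := symP w.
exists (N * D)%N; first by rewrite muln_gt0 N0.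
exists (p (1 %% N)%N) => M j t M0 /dvdnP[k ME] tE.
have pt : p (t %% N)%N = p (1 %% N)%N.
  case: tE => tE; first by rewrite tE ME -[in RHS](modnMDl (j * k * D)); congr (p (_ %% _)%N); ring.
  rewrite [RHS]pS ?ltn_pmod //; congr p.
  have [N1|N1] := leqP N 1; first by rewrite (_ : N = 1%N) ?modn1 //; lia.
  rewrite (modn_small N1); apply/eqP; rewrite -(eqn_modDr 1) subnK //.
  have -> : (t + 1 = j.+1 * k * D * N)%N by transitivity (j.+1 * M)%N; [lia|rewrite ME; ring].
  by rewrite modnMl modnn.
rewrite -pt -pE ehr_translate // -/(shifted_count W t (t%:R *: w)); congr (_%:R).
have MwE i : (i * M)%:R *: w = toQ (z *+ (i * k * N)).
  by rewrite ME !mulnA natrM -scalerA zE scaler_nat /toQ raddfMn.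
case: tE => tE; first by rewrite {2}tE natrD scalerDl MwE scale1r addrC shifted_count_lattice.
rewrite -shifted_count_opp //.
have -> : - (t%:R *: w) = w + toQ (- (z *+ (j.+1 * k * N))).
  have -> : t%:R = (j.+1 * M)%:R - 1 :> rat.
    by rewrite -[(j.+1 * M)%N](_ : t.+1 = _) -?natr1 ?addrK //; lia.
  by rewrite scalerBl MwE scale1r opprB toQN.
exact: shifted_count_lattice.
Qed.

(** Weighting the common constituents of the counts in [tP - v - e] gives one polynomial for both
    classes [1] and [-1]; the moduli are multiplied. *)
Lemma common_polynomial v (L : seq (int * 'rV[rat]_d)) :
  exists2 N : nat, (0 < N)%N & exists q : {poly R},
  forall M j t : nat, (0 < M)%N -> (N %| M)%N -> (t = j * M + 1 \/ t = j * M + (M - 1))%N ->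
    q.[t%:R] = (\sum_(p <- L) p.1 * (shifted_count W t (- v - p.2))%:R)%:~R.
Proof.
elim: L => [|[c e] L [N N0 [q qP]]].
  by exists 1%N => //; exists 0 => M j t _ _ _; rewrite horner0 big_nil.
have [N' N'0 [q' q'P]] := common_constituent (- v - e).
exists (N * N')%N; first by rewrite muln_gt0 N0.
exists (c%:~R *: q' + q) => M j t M0 NM tE.
have N1M : (N %| M)%N by apply: dvdn_trans NM; apply: dvdn_mulr.
have N2M : (N' %| M)%N by apply: dvdn_trans NM; apply: dvdn_mull.
rewrite hornerD hornerZ (qP M j) // (q'P M j) //.
by rewrite big_cons intrD intrM /= rmorph_nat.
Qed.

Lemma common_box v t (L : seq (int * 'rV[rat]_d)) :
  exists2 B : seq 'rV[int]_d, uniq B &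
    forall p z, p \in L -> conv_at W t (toQ z - (- v - p.2)) -> z \in B.
Proof.
elim: L => [|p L [B Bu BP]]; first by exists [::].
have [B' _ B'P] := conv_at_finite W t (- v - p.2).
exists (undup (B' ++ B)); first exact: undup_uniq.
move=> p' z; rewrite inE mem_undup mem_cat => /orP[/eqP->/B'P->//|p'L /(BP _ _ p'L)->].
by rewrite orbT.
Qed.

(** The weighted count is the number of lattice points [z] equal to [(t - 1) v]: one for [t = 1]
    modulo [M], which forces the common polynomial to be constantly 1, hence also one at
    [t = M - 1]. *)
Lemma half_integral_vertex v :
  is_vertex (conv (map (map_mx (@ratr R)) W)) (map_mx ratr v) ->
  exists z, 2 *: v = toQ z.
Proof.
move=> vx; have [S SP] := cone_polyhedral W.
have {}SP h (x : 'rV[rat]_d) : sat S (fcons h (x 0)) <-> conv_at W h x.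
  by rewrite SP (eq_map (@map_ratr_rat _ _)) map_id.
have [L L0 LP] := vertex_functional SP vx.
have [N N0 [q qP]] := common_polynomial v L.
have [D D0 [zD zDE]] := rational_denominator v.
(* [N] serves the common polynomial, [D] makes [M v] a lattice point, and the factor 2 ensures
   [M - 1 > 0]. *)
pose M := (2 * N * D)%N.
have M0 : (0 < M)%N by rewrite !muln_gt0 N0.
have NM : (N %| M)%N by rewrite /M mulnAC dvdn_mull.
have MvE i : (i * M)%:R *: v = toQ (zD *+ (i * 2 * N)).
  rewrite /M mulnA mulnA natrM -scalerA zDE scaler_nat.
  by rewrite /toQ raddfMn.
have count t : (0 < t)%N -> exists2 B, uniq B &
    (forall z, toQ z + v = t%:R *: v -> z \in B) /\
    \sum_(p <- L) p.1 * (shifted_count W t (- v - p.2))%:R =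
    \sum_(z <- B) (toQ z + v == t%:R *: v)%:R.
  move=> t0; have [B Bu BP] := common_box v t%:R L; exists B => //; split.
    move=> z zv; apply: (BP (1, 0)) => //=; rewrite subr0 opprK zv.
    have kv1 : conv_at W 1 v by case: vx => + _; rewrite -(conv_at_ratr R) rmorph1.
    by have := conv_at_scale (ler0n _ t) kv1; rewrite mulr1.
  transitivity (\sum_(p <- L) \sum_(z <- B) p.1 * `[< conv_at W t%:R (toQ z + v + p.2) >]%:R).
    apply: eq_big_seq => p pL; rewrite -mulr_sumr; congr (_ * _).
    rewrite /shifted_count (cntE _ Bu) => [|z]; last exact: BP.
    by apply: eq_bigr => z _; rewrite /= opprB opprK addrA addrAC.
  by rewrite exchange_big; apply: eq_bigr => z _; rewrite LP.
have q1 j : q.[(j * M + 1)%:R] = 1.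
  rewrite (qP M j) //; last by left.
  have [|B Bu [BP ->]] := count (j * M + 1)%N; first by rewrite addn1.
  have tv : (j * M + 1)%:R *: v = toQ (zD *+ (j * 2 * N)) + v.
    by rewrite natrD scalerDl MvE scale1r.
  have zB := BP _ (esym tv).
  rewrite (bigD1_seq _ zB Bu) /= tv eqxx big1 ?addr0 // => z zz.
  case: eqP => // /addIr/rowP zE; case/eqP: zz; apply/rowP => i.
  by have := zE i; rewrite !mxE => /intr_inj.
apply: contrapT => nv.
(* A lattice point [z = (M - 2) v] would make [2 v = M v - z] a lattice point. *)
have qM : q.[(0 * M + (M - 1))%:R] = 0.
  rewrite (qP M 0%N) //; last by right.
  have [|B Bu [BP ->]] := count (0 * M + (M - 1))%N; first by rewrite /M; lia.
  rewrite big1 // => z _; case: eqP => // zv; case: nv.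
  exists (zD *+ (1 * 2 * N) - z); rewrite toQB -MvE.
  move: zv => /(canRL (addrK _)) ->.
  have -> : (1 * M = (0 * M + (M - 1)).+1)%N by lia.
  move: (0 * M + _)%N => t.
  rewrite -[t.+1%:R]natr1 [in RHS]scalerDl scale1r opprB [_ + v]addrC addrACA subrr addr0.
  by rewrite scaler_nat mulr2n.
by move: qM; rewrite (poly_constant_on_progression M0 q1) hornerC => /eqP; rewrite oner_eq0.
Qed.

End SymmetricCounts.

(** * Dilated vertices and the equivalence *)

Lemma conv_at_map_scale (F : realFieldType) d (V : seq 'rV[F]_d) a h x :
  conv_at V h x -> conv_at (map ( *:%R a) V) h (a *: x).
Proof.
elim: V h x => [|v V IH] h x; first by case/conv_at_nil=> -> ->; rewrite scaler0; apply/conv_at0.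
case/conv_at_cons=> b b0 /IH k; apply/conv_at_cons; exists b => //.
by rewrite scalerA mulrC -scalerA -scalerBr.
Qed.

Lemma conv_dilate (R : realType) d (V : seq 'rV[R]_d) a : a != 0 ->
  dilate a (conv V) = conv (map ( *:%R a) V).
Proof.
move=> a0; apply/seteqP; split=> x; first by case=> y Vy ->; apply: conv_at_map_scale.
move=> /(conv_at_map_scale a^-1); rewrite -map_comp (eq_map (g := id)) => [|v /=].
  by rewrite map_id => Vx; exists (a^-1 *: x) => //; rewrite scalerA mulfV // scale1r.
by rewrite scalerA mulVf // scale1r.
Qed.

Lemma vertex_dilate (R : realType) d (P : set 'rV[R]_d) a x : a != 0 ->
  is_vertex P x -> is_vertex (dilate a P) (a *: x).
Proof.
move=> a0 [Px vx]; split; first by exists x.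
move=> _ _ [y Py ->] [z Pz ->] l l01 xE; congr (_ *: _); apply: (vx _ _ Py Pz l l01).
by apply: (scalerI a0); rewrite xE scalerDr !scalerA ![a * _]mulrC.
Qed.

Lemma dilateK (R : realType) d (P : set 'rV[R]_d) a : a != 0 ->
  dilate a^-1 (dilate a P) = P.
Proof.
move=> a0; apply/seteqP; split=> x.
  by case=> _ [y Py ->] ->; rewrite scalerA mulVf // scale1r.
by move=> Px; exists (a *: x); [exists x|rewrite scalerA mulVf // scale1r].
Qed.

Lemma rational_points_seq (R : realType) d (V : seq 'rV[R]_d) :
  (forall v, v \in V -> rational_pt v) -> exists W, V = map (map_mx ratr) W.
Proof.
elim: V => [|v V IH] VQ; first by exists [::].
have [q ->] := VQ v (mem_head _ _).
have [W ->] : exists W, V = map (map_mx ratr) W.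
  by apply: IH => w wV; apply: VQ; rewrite inE wV orbT.
by exists (q :: W).
Qed.

Lemma map_ratr_toQ (R : realType) d (z : 'rV[int]_d) :
  map_mx ratr (toQ z) = map_mx intr z :> 'rV[R]_d.
Proof. by apply/rowP => i; rewrite !mxE ratr_int. Qed.

Theorem theorem1p6 (R : realType) (d : nat) (P : set 'rV[R]_d) :
  rational_polytope P -> full_dim P -> neg_sym P ->
  ((forall w : 'rV[rat]_d,
      symmetric_qp R (ehr (translate P (map_mx (fun r => ratr r) w))))
   <-> integral_polytope (dilate 2 P)).
Proof.
move=> [[V0 PV0] vQ] [x0 [e e0 xe]] PN.
have Px0 : P x0 by apply: xe => i; rewrite subrr normr0.
have [WR VW vW] := conv_vertices V0.
have [W WE] : exists W, WR = map (map_mx ratr) W.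
  by apply: rational_points_seq => v /vW; rewrite -PV0; apply: vQ.
have PE : P = conv (map (map_mx ratr) W) by rewrite PV0 VW WE.
have two0 : 2 != 0 :> R by rewrite pnatr_eq0.
have vP w : w \in W -> is_vertex P (map_mx ratr w).
  by move=> wW; rewrite PV0; apply: vW; rewrite WE map_f.
have W0 : W != [::].
  apply/eqP => WN; move: Px0; rewrite PE WN => /conv_at_nil[/eqP].
  by rewrite oner_eq0.
have WN w : w \in W -> conv_at W 1 (- w).
  move=> /vP[/PN + _]; rewrite -map_mxN PE -(conv_at_ratr R) rmorph1; exact.
split=> [symP|[_ vZ] w].
  split=> [|x vx]; first by exists (map ( *:%R 2) V0); rewrite PV0 conv_dilate.
  (* Halving sends vertices of [2P] to vertices of [P], which are rational. *)
  have vx2 : is_vertex P (2^-1 *: x).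
    by rewrite -(dilateK P two0); apply: vertex_dilate => //; rewrite invr_eq0.
  have [v vE] := vQ _ vx2; move: vx2; rewrite vE PE => vx2.
  rewrite PE in symP.
  have [z zE] := half_integral_vertex W0 WN symP vx2.
  exists z; rewrite -[map_mx _ z]map_ratr_toQ -zE map_mxZ rmorph_nat -vE.
  by rewrite scalerA mulfV // scale1r.
rewrite PE; apply: symmetric_translates => // v /vP/(vertex_dilate two0)/vZ[z zE].
exists z; apply: (@map_ratr_inj _ R).
by rewrite map_mxZ rmorph_nat map_ratr_toQ.
Qed.
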